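(* Let $\mathbf M\in\mathbb S^n_{++}$. The Levi-Civita connection of $\mathcal M_{\rm gbw}$ is given, for any smooth vector fields $\xi,\eta$ on $\mathcal M_{\rm gbw}$, at the point $\mathbf X\in\mathbb S^n_{++}$ by $$\nabla_\xi\eta=\mathrm D_\xi\eta+\{\mathbf X\mathcal L_{\mathbf X,\mathbf M}[\eta]\mathbf M\mathcal L_{\mathbf X,\mathbf M}[\xi]\mathbf M+\mathbf X\mathcal L_{\mathbf X,\mathbf M}[\xi]\mathbf M\mathcal L_{\mathbf X,\mathbf M}[\eta]\mathbf M\}_{\rm S}-\{\mathbf M\mathcal L_{\mathbf X,\mathbf M}[\eta]\xi\}_{\rm S}-\{\mathbf M\mathcal L_{\mathbf X,\mathbf M}[\xi]\eta\}_{\rm S}.$$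
   Context: $\mathbb S^n$ is the space of real symmetric $n\times n$ matrices and $\mathbb S^n_{++}$ the open subset of positive definite ones. $\{\mathbf A\}_{\rm S}=\frac12(\mathbf A+\mathbf A^\top)$. For $\mathbf X,\mathbf M\in\mathbb S^n_{++}$ and $\mathbf U\in\mathbb S^n$, $\mathcal L_{\mathbf X,\mathbf M}[\mathbf U]$ is the unique solution $\mathbf L$ of $\mathbf X\mathbf L\mathbf M+\mathbf M\mathbf L\mathbf X=\mathbf U$. $\mathcal M_{\rm gbw}$ is the manifold $\mathbb S^n_{++}$ with the generalized Bures-Wasserstein metric $g_{\rm gbw}(\mathbf U,\mathbf V)=\frac12\operatorname{tr}(\mathcal L_{\mathbf X,\mathbf M}[\mathbf U]\mathbf V)$ at $\mathbf X$, $\mathbf U,\mathbf V\in T_{\mathbf X}\mathbb S^n_{++}=\mathbb S^n$. Vector fields are regarded as $\mathbb S^n$-valued functions on $\mathbb S^n_{++}$, and $\mathrm D_\xi\eta$ is the ordinary (Euclidean) directional derivative of $\eta$ along $\xi$. *)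

(* Defs.v *)
From HB Require Import structures.
From mathcomp Require Import all_boot all_order all_algebra.
From mathcomp Require Import all_classical all_reals all_analysis.

Set Implicit Arguments.
Unset Strict Implicit.
Unset Printing Implicit Defensive.

Import Order.TTheory GRing.Theory Num.Theory.
Import numFieldNormedType.Exports.

Local Open Scope classical_set_scope.
Local Open Scope ring_scope.

Section Spd.
Context {R : realType} {n : nat}.

Definition symmetric_mx : set 'M[R]_n := [set A | A^T = A].

Definition spd : set 'M[R]_n :=
  [set A | symmetric_mx A /\
           forall u : 'cV[R]_n, u != 0 -> 0 < (u^T *m A *m u) ord0 ord0].

Definition sym_part (A : 'M[R]_n) : 'M[R]_n := 2^-1 *: (A + A^T).

(* The solution is unique when X and M are positive definite; [xget] selects
   it.  The value 0 is used only when the equation has no solution. *)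
Definition gen_lyapunov (M X U : 'M[R]_n) : 'M[R]_n :=
  xget 0 [set L : 'M[R]_n | X *m L *m M + M *m L *m X = U].

Definition gbw_metric (M X U V : 'M[R]_n) : R :=
  2^-1 * \tr (gen_lyapunov M X U *m V).

End Spd.

(* Functions on the manifold [spd] are represented by total functions on
   'M[R]_n; all the notions below only depend on their values on [spd].  As
   [spd] is open in the space of symmetric matrices, for X in [spd] and V
   symmetric the line X + h V stays in [spd] for small h, so that derivatives
   along V at X are intrinsic. *)
Section Smooth.
Context {R : realType} {n : nat} {W : normedModType R}.
Implicit Types f : 'M[R]_n -> W.

(* C^k on an open set of the vector space of symmetric matrices: the iterated
   directional derivatives up to order k exist and are continuous. *)
Fixpoint Ck_on_spd (k : nat) f : Prop :=
  {within spd, continuous f} /\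
  if k is k'.+1 then
    forall V : 'M[R]_n, symmetric_mx V ->
      (forall X, spd X -> derivable f X V) /\ Ck_on_spd k' ('D_V f)
  else True.

Definition smooth_on_spd f : Prop := forall k, Ck_on_spd k f.

Definition deriv_along (xi : 'M[R]_n -> 'M[R]_n) f : 'M[R]_n -> W :=
  fun X => 'D_(xi X) f X.

End Smooth.

Section Connection.
Context {R : realType} {n : nat}.
Implicit Types xi eta zeta : 'M[R]_n -> 'M[R]_n.

Definition smooth_vector_field xi : Prop :=
  smooth_on_spd xi /\ {homo xi : X / spd X >-> symmetric_mx X}.

Definition smooth_function (f : 'M[R]_n -> R) : Prop :=
  smooth_on_spd (f : 'M[R]_n -> R^o).

(* In the global chart given by the inclusion of [spd] in the vector space of
   symmetric matrices. *)
Definition lie_bracket xi eta : 'M[R]_n -> 'M[R]_n :=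
  fun X => deriv_along xi eta X - deriv_along eta xi X.

Definition connection_op :=
  ('M[R]_n -> 'M[R]_n) -> ('M[R]_n -> 'M[R]_n) -> 'M[R]_n -> 'M[R]_n.

Record affine_connection (nabla : connection_op) : Prop := AffineConnection {
  (* [nabla] descends to vector fields on [spd] *)
  connection_ext : forall xi xi' eta eta',
    smooth_vector_field xi -> smooth_vector_field xi' ->
    smooth_vector_field eta -> smooth_vector_field eta' ->
    {in spd, xi =1 xi'} -> {in spd, eta =1 eta'} ->
    {in spd, nabla xi eta =1 nabla xi' eta'};
  connection_smooth : forall xi eta,
    smooth_vector_field xi -> smooth_vector_field eta ->
    smooth_vector_field (nabla xi eta);
  connection_linearl : forall (f : 'M[R]_n -> R) xi xi' eta,
    smooth_function f -> smooth_vector_field xi ->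
    smooth_vector_field xi' -> smooth_vector_field eta ->
    forall X, spd X ->
      nabla (fun Y => f Y *: xi Y + xi' Y) eta X =
      f X *: nabla xi eta X + nabla xi' eta X;
  connection_linearr : forall (a : R) xi eta eta',
    smooth_vector_field xi -> smooth_vector_field eta ->
    smooth_vector_field eta' ->
    forall X, spd X ->
      nabla xi (fun Y => a *: eta Y + eta' Y) X =
      a *: nabla xi eta X + nabla xi eta' X;
  connection_leibniz : forall (f : 'M[R]_n -> R) xi eta,
    smooth_function f -> smooth_vector_field xi -> smooth_vector_field eta ->
    forall X, spd X ->
      nabla xi (fun Y => f Y *: eta Y) X =
      f X *: nabla xi eta X +
      deriv_along xi (f : 'M[R]_n -> R^o) X *: eta X }.

Definition torsion_free (nabla : connection_op) : Prop :=
  forall xi eta, smooth_vector_field xi -> smooth_vector_field eta ->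
  forall X, spd X ->
    nabla xi eta X - nabla eta xi X = lie_bracket xi eta X.

(* [g X U V] is the inner product of the tangent vectors U and V at X. *)
Definition metric_compatible (g : 'M[R]_n -> 'M[R]_n -> 'M[R]_n -> R)
    (nabla : connection_op) : Prop :=
  forall xi eta zeta,
    smooth_vector_field xi -> smooth_vector_field eta ->
    smooth_vector_field zeta ->
  forall X, spd X ->
    deriv_along xi ((fun Y => g Y (eta Y) (zeta Y)) : 'M[R]_n -> R^o) X =
    g X (nabla xi eta X) (zeta X) + g X (eta X) (nabla xi zeta X).

Definition levi_civita (g : 'M[R]_n -> 'M[R]_n -> 'M[R]_n -> R)
    (nabla : connection_op) : Prop :=
  [/\ affine_connection nabla, torsion_free nabla & metric_compatible g nabla].

Definition gbw_connection (M : 'M[R]_n) : connection_op := fun xi eta X =>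
  let L := gen_lyapunov M X in
  deriv_along xi eta X
  + sym_part (X *m L (eta X) *m M *m L (xi X) *m M
              + X *m L (xi X) *m M *m L (eta X) *m M)
  - sym_part (M *m L (eta X) *m xi X)
  - sym_part (M *m L (xi X) *m eta X).

End Connection.

(* Main.v *)
Require Import Defs.
From HB Require Import structures.
From mathcomp Require Import all_boot all_order all_algebra.
From mathcomp Require Import all_classical all_reals all_analysis.
From mathcomp Require Import ring lra.
Import Order.TTheory GRing.Theory Num.Theory.
Import numFieldNormedType.Exports.
Local Open Scope classical_set_scope.
Local Open Scope ring_scope.
Set Implicit Arguments.
Unset Strict Implicit.
Unset Printing Implicit Defensive.

(** The Lyapunov operator [L |-> X L M + M L X] is injective, hence bijective,
    because [tr (L^T X L M)] and [tr (L^T M L X)] are nonnegative and the first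
    one vanishes only at [L = 0].  Differentiating [X L M + M L X = U] along
    [V] gives [D_V (L_X[U]) = L_X[D_V U - (V L M + M L V)]], which yields both
    smoothness and the derivative of the metric.  Write [G(xi, eta)] for the
    correction term of the connection, [a], [b], [c] for the solutions
    [L_X[xi]], [L_X[eta]], [L_X[zeta]] and [T(p,q,r) = tr (X p M q M r)], which
    satisfies [T(p,q,r) = T(r,q,p)] for symmetric arguments.  Then
    [tr (G(xi,eta) c) = - 2 T(a,c,b)] while the derivative of the metric
    contributes [- 2 T(a,b,c) - 2 T(a,c,b)]: this is metric compatibility.
    The term [G] is symmetric, hence there is no torsion.  For uniqueness, the
    difference of two Levi-Civita connections is symmetric in its two arguments
    and skew for the metric, so it vanishes. *)

(** * Positive definite matrices and the Lyapunov operator *)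

Section PositiveDefinite.
Context {R : realType}.

Lemma spd_sym n (A : 'M[R]_n) : spd A -> A^T = A.
Proof. by case. Qed.

Lemma spd_ge0 n (A : 'M[R]_n) (u : 'cV[R]_n) :
  spd A -> 0 <= (u^T *m A *m u) ord0 ord0.
Proof.
move=> [_ pA]; have [->|/pA/ltW//] := eqVneq u 0.
by rewrite mulmx0 mxE.
Qed.

Lemma spd_unitmx n (A : 'M[R]_n) : spd A -> A \in unitmx.
Proof.
move=> [_ pA]; rewrite -row_free_unit; apply/inj_row_free => u uA0.
apply/eqP/negP => /negP u0; have := pA u^T.
by rewrite trmxK uA0 mul0mx mxE ltxx trmx_eq0 u0 => /(_ isT).
Qed.

(** Induction on the size. With corner [a], column [b] and remainder [D], the Schur complement
    [D - a^-1 b b^T] is again positive definite, and its factor [C'] completes the column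
    [(sqrt a, b / sqrt a)] to a factor of [A]. *)
Lemma spd_cholesky n (A : 'M[R]_n) : spd A -> exists C : 'M[R]_n, C *m C^T = A.
Proof.
elim: n A => [|n IHn] A; first by exists A; apply/matrixP => -[].
rewrite -[n.+1]/(1 + n)%N in A *; move=> [sA pA].
pose a := A ord0 ord0; pose b := dlsubmx A : 'cV_n; pose D := drsubmx A.
have Eul : ulsubmx A = a%:M.
  by rewrite [LHS]mx11_scalar !mxE; congr (A _ _)%:M; apply/val_inj.
have Eur : ursubmx A = b^T by rewrite /b trmx_dlsub sA.
have EA : A = block_mx a%:M b^T b D by rewrite -[LHS]submxK Eul Eur.
have sD : D^T = D by rewrite /D trmx_drsub sA.
have a_gt0 : 0 < a.
  have : col_mx (1%:M : 'M[R]_1) (0 : 'cV[R]_n) != 0.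
    by rewrite col_mx_eq0 oner_eq0.
  move=> /pA; rewrite EA tr_col_mx mul_row_block mul_row_col.
  by rewrite !trmx0 !mul0mx !mulmx0 !addr0 trmx1 mul1mx mulmx1 mxE.
have aN0 : a != 0 by rewrite gt_eqF.
have [|C' CC'] := IHn (D - a^-1 *: (b *m b^T)).
  split; first by rewrite /symmetric_mx /= linearB linearZ/= trmx_mul trmxK sD.
  (* This [w] solves [a w + b^T v = 0], so the form of [A] at [(w, v)] reduces to that of the Schur
     complement at [v]. *)
  move=> v v0; pose w := - a^-1 *: (b^T *m v).
  have /pA : col_mx w v != 0 by rewrite col_mx_eq0 negb_and v0 orbT.
  rewrite EA tr_col_mx mul_row_block mul_row_col.
  suff -> : w^T *m a%:M + v^T *m b = 0.
    rewrite mul0mx add0r mulmxDl -mulmxA.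
    suff -> : w^T *m (b^T *m v) + v^T *m D *m v =
      v^T *m (D - a^-1 *: (b *m b^T)) *m v by [].
    rewrite /w linearZ /= trmx_mul trmxK mulmxBr mulmxBl addrC; congr (_ + _).
    by rewrite -!scalemxAl -scalemxAr -scalemxAl scaleNr !mulmxA.
  rewrite /w linearZ/= trmx_mul trmxK mul_mx_scalar scalerA mulrN divff //.
  by rewrite scaleN1r addNr.
exists (block_mx (Num.sqrt a)%:M 0 ((Num.sqrt a)^-1 *: b) C').
have s2 : Num.sqrt a * Num.sqrt a = a by rewrite -expr2 sqr_sqrtr // ltW.
have sN0 : Num.sqrt a != 0 by rewrite gt_eqF // sqrtr_gt0.
rewrite tr_block_mx mulmx_block !trmx0 !mulmx0 !mul0mx !addr0 CC' EA.
congr block_mx.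
- by rewrite tr_scalar_mx -scalar_mxM s2.
- by rewrite linearZ/= mul_scalar_mx scalerA divff // scale1r.
- by rewrite tr_scalar_mx mul_mx_scalar scalerA divff // scale1r.
- rewrite linearZ/= -scalemxAl -scalemxAr scalerA -invfM s2.
  by rewrite addrC subrK.
Qed.

Lemma trace_quadE m n (A : 'M[R]_n) (B : 'M[R]_(n, m)) :
  \tr (B^T *m A *m B) =
  \sum_j ((col j B)^T *m A *m col j B) ord0 ord0.
Proof.
apply: eq_bigr => j _; rewrite !mxE; apply: eq_bigr => k _.
rewrite !mxE; congr (_ * _); apply: eq_bigr => l _; rewrite !mxE //.
Qed.

Lemma trace_quad_ge0 m n (A : 'M[R]_n) (B : 'M[R]_(n, m)) :
  spd A -> 0 <= \tr (B^T *m A *m B).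
Proof.
by move=> pA; rewrite trace_quadE sumr_ge0 // => j _; exact: spd_ge0.
Qed.

Lemma trace_quad_eq0 m n (A : 'M[R]_n) (B : 'M[R]_(n, m)) :
  spd A -> \tr (B^T *m A *m B) = 0 -> B = 0.
Proof.
move=> pA; rewrite trace_quadE => /psumr_eq0P B0; apply/matrixP => i j.
have [/colP/(_ i)|cN0] := eqVneq (col j B) 0; first by rewrite !mxE.
have := pA.2 _ cN0; rewrite B0 ?ltxx // => k _; exact: spd_ge0.
Qed.

(** Factoring [B = C C^T], cyclicity gives the trace of [(L C)^T A (L C)], a sum of values of the
    form of [A] at the columns of [L C]; as [C] is invertible, [L C = 0] forces [L = 0]. *)
Lemma trace_spd2_ge0 n (A B L : 'M[R]_n) : spd A -> spd B ->
  0 <= \tr (L^T *m A *m L *m B) /\ (\tr (L^T *m A *m L *m B) = 0 -> L = 0).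
Proof.
move=> pA pB; have [C CB] := spd_cholesky pB.
have -> : \tr (L^T *m A *m L *m B) = \tr ((L *m C)^T *m A *m (L *m C)).
  by rewrite -CB mulmxA mxtrace_mulC trmx_mul !mulmxA.
split; first exact: trace_quad_ge0.
move=> /(trace_quad_eq0 pA) LC0.
have : C \in unitmx by move: (spd_unitmx pB); rewrite -CB unitmx_mul => /andP[].
by move=> uC; rewrite -(mulmxK uC L) LC0 mul0mx.
Qed.

End PositiveDefinite.

Section Lyapunov.
Context {R : realType} {n : nat}.
Implicit Types M X L U : 'M[R]_n.

Lemma lyapunov_inj M X L :
  spd M -> spd X -> X *m L *m M + M *m L *m X = 0 -> L = 0.
Proof.
move=> pM pX /(congr1 (fun A => \tr (L^T *m A))).
rewrite mulmx0 mxtrace0 mulmxDr mxtraceD !mulmxA.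
have [t1 h1] := trace_spd2_ge0 L pX pM; have [t2 _] := trace_spd2_ge0 L pM pX.
by move=> /eqP; rewrite paddr_eq0 // => /andP[/eqP/h1].
Qed.

(** The matrix of [L |-> X L M + M L X] on flattened matrices, which turns solving the equation into
    [invmx]. *)
Definition lyapunov_mx M X : 'M[R]_(n * n) :=
  lin_mulmx X *m lin_mulmxr M + lin_mulmx M *m lin_mulmxr X.

Lemma mul_lyapunov_mx M X L :
  mxvec L *m lyapunov_mx M X = mxvec (X *m L *m M + M *m L *m X).
Proof. by rewrite mulmxDr !mulmxA !mul_vec_lin /= !linearD. Qed.

Lemma lyapunov_unitmx M X : spd M -> spd X -> lyapunov_mx M X \in unitmx.
Proof.
move=> pM pX; rewrite -row_free_unit; apply/inj_row_free => u.
rewrite -[u]vec_mxK mul_lyapunov_mx => /(canRL mxvecK); rewrite linear0.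
by move=> /(lyapunov_inj pM pX) ->; rewrite linear0.
Qed.

(** Replaces the choice made by [xget] with a closed formula, from which linearity and continuity
    can be read off. *)
Lemma gen_lyapunovE M X U : spd M -> spd X ->
  gen_lyapunov M X U = vec_mx (mxvec U *m invmx (lyapunov_mx M X)).
Proof.
move=> pM pX; set L := RHS.
have LE : X *m L *m M + M *m L *m X = U.
  apply: (can_inj mxvecK); rewrite -mul_lyapunov_mx vec_mxK.
  by rewrite mulmxKV // lyapunov_unitmx.
rewrite /gen_lyapunov; case: xgetP => [L' _ /= L'E|/(_ L)/(_ LE)//].
apply/eqP; rewrite -subr_eq0; apply/eqP/(lyapunov_inj pM pX).
rewrite !mulmxBr !mulmxBl addrACA L'E -opprD LE subrr //.
Qed.

Lemma gen_lyapunovP M X U : spd M -> spd X ->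
  X *m gen_lyapunov M X U *m M + M *m gen_lyapunov M X U *m X = U.
Proof.
move=> pM pX; apply: (can_inj mxvecK); rewrite -mul_lyapunov_mx gen_lyapunovE //.
by rewrite vec_mxK mulmxKV // lyapunov_unitmx.
Qed.

Lemma gen_lyapunov_uniq M X L : spd M -> spd X ->
  gen_lyapunov M X (X *m L *m M + M *m L *m X) = L.
Proof.
move=> pM pX; rewrite gen_lyapunovE // -mul_lyapunov_mx mulmxK ?mxvecK //.
exact: lyapunov_unitmx.
Qed.

Lemma gen_lyapunov_linear M X : spd M -> spd X -> linear (gen_lyapunov M X).
Proof.
move=> pM pX a U V; rewrite !gen_lyapunovE //.
by rewrite !(linearP, mulmxDl, linearD, linearZ) /= -?scalemxAl !linearZ.
Qed.

(** The transpose of the solution solves the equation with right-hand side [U^T = U], and the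
    solution is unique. *)
Lemma gen_lyapunov_sym M X U : spd M -> spd X ->
  symmetric_mx U -> symmetric_mx (gen_lyapunov M X U).
Proof.
move=> pM pX sU; rewrite /symmetric_mx/=.
rewrite -[LHS](@gen_lyapunov_uniq M X) //; congr gen_lyapunov.
rewrite -[RHS]sU -[in RHS](@gen_lyapunovP M X U) // linearD /= !trmx_mul.
by rewrite (spd_sym pM) (spd_sym pX) !mulmxA addrC.
Qed.

End Lyapunov.

(** * Limits of matrices and openness of [spd] *)

Section MatrixLimits.
Context {R : realType} {T : Type} {F : set_system T} {FF : Filter F}.

Lemma cvg_mxP m n (f : T -> 'M[R]_(m, n)) (A : 'M[R]_(m, n)) :
  (forall i j, f t i j @[t --> F] --> A i j) -> f t @[t --> F] --> A.
Proof.
move=> fA; apply/cvg_ballP => e e0.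
have H : \forall t \near F, forall i j, ball (A i j) e (f t i j).
  apply: filter_forall => i; apply: filter_forall => j.
  exact: (cvg_ball (fA i j)).
by apply: filterS H => t At; split.
Qed.

Lemma cvg_mx_coord m n (f : T -> 'M[R]_(m, n)) (A : 'M[R]_(m, n)) i j :
  f t @[t --> F] --> A -> f t i j @[t --> F] --> A i j.
Proof.
by move=> fA; exact: (cvg_comp _ _ fA (@coord_continuous _ _ _ i j A)).
Qed.

Lemma cvg_sumr I (r : seq I) (P : pred I) (f : I -> T -> R) (a : I -> R) :
  (forall i, P i -> f i t @[t --> F] --> a i) ->
  \sum_(i <- r | P i) f i t @[t --> F] --> \sum_(i <- r | P i) a i.
Proof. by move=> fa; apply: cvg_big => //; exact: add_continuous. Qed.

Lemma cvg_prodr I (r : seq I) (P : pred I) (f : I -> T -> R) (a : I -> R) :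
  (forall i, P i -> f i t @[t --> F] --> a i) ->
  \prod_(i <- r | P i) f i t @[t --> F] --> \prod_(i <- r | P i) a i.
Proof. by move=> fa; apply: cvg_big => //; exact: mul_continuous. Qed.

Lemma cvg_mulmx m n p (f : T -> 'M[R]_(m, n)) (g : T -> 'M[R]_(n, p))
    (A : 'M[R]_(m, n)) (B : 'M[R]_(n, p)) :
  f t @[t --> F] --> A -> g t @[t --> F] --> B ->
  f t *m g t @[t --> F] --> A *m B.
Proof.
move=> fA gB; apply: cvg_mxP => i j; rewrite mxE.
under eq_fun do rewrite mxE.
by apply: cvg_sumr => k _; apply: cvgM; exact: cvg_mx_coord.
Qed.

Lemma cvg_trmx m n (f : T -> 'M[R]_(m, n)) (A : 'M[R]_(m, n)) :
  f t @[t --> F] --> A -> (f t)^T @[t --> F] --> A^T.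
Proof.
move=> fA; apply: cvg_mxP => i j; rewrite mxE.
by under eq_fun do rewrite mxE; exact: cvg_mx_coord.
Qed.

Lemma cvg_mxtrace n (f : T -> 'M[R]_n) (A : 'M[R]_n) :
  f t @[t --> F] --> A -> \tr (f t) @[t --> F] --> \tr A.
Proof. by move=> fA; apply: cvg_sumr => i _; exact: cvg_mx_coord. Qed.

Lemma cvg_mxvec m n (f : T -> 'M[R]_(m, n)) (A : 'M[R]_(m, n)) :
  f t @[t --> F] --> A -> mxvec (f t) @[t --> F] --> mxvec A.
Proof.
move=> fA; apply: cvg_mxP => i k; rewrite (ord1 i).
case/mxvec_indexP: k => k l; rewrite mxvecE.
by under eq_fun do rewrite mxvecE; exact: cvg_mx_coord.
Qed.

Lemma cvg_vec_mx m n (f : T -> 'rV[R]_(m * n)) (A : 'rV[R]_(m * n)) :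
  f t @[t --> F] --> A -> vec_mx (f t) @[t --> F] --> vec_mx A.
Proof.
move=> fA; apply: cvg_mxP => i j; rewrite mxE.
by under eq_fun do rewrite mxE; exact: cvg_mx_coord.
Qed.

Lemma cvg_det n (f : T -> 'M[R]_n) (A : 'M[R]_n) :
  f t @[t --> F] --> A -> \det (f t) @[t --> F] --> \det A.
Proof.
move=> fA; apply: cvg_sumr => s _; apply: cvgM; first exact: cvg_cst.
by apply: cvg_prodr => i _; exact: cvg_mx_coord.
Qed.

Lemma cvg_invmx n (f : T -> 'M[R]_n) (A : 'M[R]_n) : A \in unitmx ->
  (\forall t \near F, f t \in unitmx) ->
  f t @[t --> F] --> A -> invmx (f t) @[t --> F] --> invmx A.
Proof.
move=> uA uf fA; rewrite [invmx A]/invmx uA.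
(* Outside [unitmx], [invmx] returns its argument, so the cofactor formula holds only eventually
   along [F]; its terms are polynomial in the entries, up to the inverse of the determinant. *)
apply: (@cvg_trans _ ((fun t => (\det (f t))^-1 *: \adj (f t)) @ F)).
  by apply: near_eq_cvg; apply: filterS uf => t ut; rewrite /invmx ut.
apply: cvgZ; first by apply: cvgV; [rewrite -unitfE -unitmxE|exact: cvg_det].
apply: cvg_mxP => i j; rewrite mxE.
under eq_fun do rewrite mxE.
apply: cvgM; first exact: cvg_cst.
apply: cvg_det; apply: cvg_mxP => k l; rewrite !mxE.
by under eq_fun do rewrite !mxE; exact: cvg_mx_coord.
Qed.

(** The matrix only records the values on finitely many basis matrices, so pointwise convergence
    suffices. *)
Lemma cvg_lin_mx m n p q (f : T -> 'M[R]_(m, n) -> 'M[R]_(p, q)) g :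
  (forall L, f t L @[t --> F] --> g L) -> lin_mx (f t) @[t --> F] --> lin_mx g.
Proof.
move=> fg; apply: cvg_mxP => i j; rewrite !mxE.
by under eq_fun do rewrite !mxE; apply: cvg_mx_coord; exact: cvg_mxvec.
Qed.

(** Joint continuity in the base point and the right-hand side. The filter is arbitrary so as to
    serve both within [spd] and along a punctured line. *)
Lemma cvg_gen_lyapunov n (M X U : 'M[R]_n) (x u : T -> 'M[R]_n) :
  spd M -> spd X -> (\forall t \near F, spd (x t)) ->
  x t @[t --> F] --> X -> u t @[t --> F] --> U ->
  gen_lyapunov M (x t) (u t) @[t --> F] --> gen_lyapunov M X U.
Proof.
move=> pM pX px xX uU; rewrite gen_lyapunovE //.
apply: (@cvg_trans _ ((fun t => vec_mx (mxvec (u t)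
  *m invmx (lyapunov_mx M (x t)))) @ F)).
  by apply: near_eq_cvg; apply: filterS px => t pt; rewrite gen_lyapunovE.
apply: cvg_vec_mx; apply: cvg_mulmx; first exact: cvg_mxvec.
apply: cvg_invmx; first exact: lyapunov_unitmx.
  by apply: filterS px => t pt; exact: lyapunov_unitmx.
apply: cvgD; apply: cvg_mulmx; try exact: cvg_cst.
- by apply: cvg_lin_mx => L; apply: cvg_mulmx => //; exact: cvg_cst.
- by apply: cvg_lin_mx => L; apply: cvg_mulmx => //; exact: cvg_cst.
Qed.

End MatrixLimits.

Section Openness.
Context {R : realType} {n : nat}.
Implicit Types X Y V : 'M[R]_n.

(** Every product [|w i| |w j|] is at most [w^T w], by [2 a b <= a^2 + b^2]. *)
Lemma quad_ge (B : 'M[R]_n) (w : 'cV[R]_n) :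
  - (\sum_i \sum_j `|B i j|) * (w^T *m w) ord0 ord0
  <= (w^T *m B *m w) ord0 ord0.
Proof.
set s := (w^T *m w) ord0 ord0.
have s2 i j : `|w i ord0| * `|w j ord0| <= s.
  have sE : s = \sum_k w k ord0 ^+ 2.
    by rewrite /s mxE; apply: eq_bigr => k _; rewrite mxE expr2.
  have h k : `|w k ord0| ^+ 2 <= s.
    rewrite real_normK ?num_real // sE (bigD1 k) //= lerDl.
    by apply: sumr_ge0 => l _; exact: sqr_ge0.
  by move: (h i) (h j); nra.
rewrite mulNr lerNl -[leLHS]mulN1r !mxE mulN1r.
apply: (le_trans (ler_norm _)); rewrite normrN.
apply: (le_trans (ler_norm_sum _ _ _)).
rewrite exchange_big mulr_suml ler_sum //= => j _.
rewrite !mxE normrM (le_trans (ler_wpM2r (normr_ge0 _) (ler_norm_sum _ _ _))) //.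
rewrite !mulr_suml ler_sum // => i _.
by rewrite !mxE normrM mulrAC mulrC ler_wpM2l.
Qed.

(** With [X = C C^T] and [w = C^T u], the form of [Y] at [u] is [w^T w + w^T B w], where
    [B = C^-1 (Y - X) C^-T] tends to 0 as [Y] tends to [X]. The form is positive once the absolute
    entries of [B] sum to less than 1. *)
Lemma spd_near X : spd X -> \forall Y \near X, symmetric_mx Y -> spd Y.
Proof.
move=> pX; have [C CX] := spd_cholesky pX.
have uC : C^T \in unitmx.
  by move: (spd_unitmx pX); rewrite -CX unitmx_mul unitmx_tr => /andP[].
pose D := invmx C^T; pose B Y := D^T *m (Y - X) *m D.
have : \sum_i \sum_j `|B Y i j| @[Y --> X] --> \sum_i \sum_j `|B X i j|.
  apply: (@cvg_sumr _ _ (nbhs X)) => i _.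
  apply: (@cvg_sumr _ _ (nbhs X)) => j _.
  apply: cvg_norm; apply: cvg_mx_coord; apply: cvg_mulmx; last exact: cvg_cst.
  apply: cvg_mulmx; first exact: cvg_cst.
  by apply: (@cvgB _ _ _ (nbhs X)); [exact: cvg_id|exact: cvg_cst].
have -> : \sum_i \sum_j `|B X i j| = 0.
  rewrite big1 // => i _; rewrite big1 // => j _.
  by rewrite /B subrr mulmx0 mul0mx mxE normr0.
move=> /cvgr0Pnorm_lt /(_ 1 ltr01); apply: filterS => Y B1 sY.
split=> // u u0; have [w wE] : exists w, w = C^T *m u by exists (C^T *m u).
have uE : u = D *m w by rewrite wE mulKmx.
have ww : (w^T *m w) = u^T *m X *m u.
  by rewrite wE trmx_mul trmxK -CX !mulmxA.
have ww0 : 0 < (w^T *m w) ord0 ord0 by rewrite ww; exact: pX.2.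
have -> : u^T *m Y *m u = w^T *m w + w^T *m B Y *m w.
  have -> : w^T *m B Y *m w = u^T *m (Y - X) *m u.
    by rewrite /B !mulmxA -trmx_mul -uE -(mulmxA _ D) -uE.
  by rewrite ww mulmxBr mulmxBl addrC subrK.
rewrite mxE; apply: (@lt_le_trans _ _
    ((1 - \sum_i \sum_j `|B Y i j|) * (w^T *m w) ord0 ord0)).
  rewrite mulr_gt0 // subr_gt0; move: B1; rewrite ger0_norm //.
  by do 2!apply: sumr_ge0 => ? _.
by rewrite mulrBl mul1r lerD2l -mulNr quad_ge.
Qed.

End Openness.

(** * Directional derivatives *)

Section LineDerivative.
Context {R : realType} {V W : normedModType R}.
Implicit Types (f : V -> W) (a v : V).

Lemma is_deriveP f a v df : is_derive a v f df <->
  h^-1 *: (f (h *: v + a) - f a) @[h --> 0^'] --> df.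
Proof.
split=> [[fv <-]|fdf]; first exact: fv.
by split; [apply/cvg_ex; exists df|exact/cvg_lim].
Qed.

Lemma cvg_line a v : h *: v + a @[h --> (0 : R)^'] --> a.
Proof.
rewrite -[X in _ --> X]add0r -[X in X + _](scale0r v).
apply: cvgD; last exact: cvg_cst.
by apply: cvgZr_tmp; exact: nbhs_dnbhs.
Qed.

Lemma is_derive_cvg_line f a v df : is_derive a v f df ->
  f (h *: v + a) @[h --> (0 : R)^'] --> f a.
Proof.
move=> /is_deriveP fdf.
rewrite -[X in _ --> X]add0r -[X in X + _](scale0r df).
apply: (@cvg_trans _ (h *: (h^-1 *: (f (h *: v + a) - f a)) + f a @[h --> 0^'])).
  apply: near_eq_cvg; near=> h; rewrite scalerA divff ?scale1r ?subrK //.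
  by near: h; exact: nbhs_dnbhs_neq.
by apply: cvgD; [apply: cvgZ => //; exact: nbhs_dnbhs|exact: cvg_cst].
Unshelve. all: by end_near. Qed.

(** Agreement is asked along the line only: [spd] is open among symmetric matrices, not among all
    matrices. *)
Lemma is_derive_near_line f g a v df :
  (\forall h \near (0 : R)^', f (h *: v + a) = g (h *: v + a)) -> f a = g a ->
  is_derive a v f df -> is_derive a v g df.
Proof.
move=> fg fga /is_deriveP fdf; apply/is_deriveP; apply: cvg_trans fdf.
by apply: near_eq_cvg; apply: filterS fg => h fgh; rewrite fgh fga.
Qed.

Lemma is_derive_dirZ f a v df (c : R) :
  is_derive a v f df -> is_derive a (c *: v) f (c *: df).
Proof.
have [->|c0] := eqVneq c 0; first by rewrite !scale0r => _; exact: is_derive0.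
move=> /is_deriveP fdf; apply/is_deriveP.
(* The substitution [h -> h c] must preserve the punctured filter, hence the separate case
   [c = 0]. *)
have ch0 : h * c @[h --> 0^'] --> (0 : R).
  rewrite -[X in _ --> X](mul0r c).
  by apply: cvgM; [exact: nbhs_dnbhs|exact: cvg_cst].
have ch : h * c @[h --> 0^'] --> (0 : R)^'.
  move=> P /ch0; apply: filterS2 (nbhs_dnbhs_neq (0 : R)) => h h0; apply.
  by rewrite mulf_neq0.
apply: (@cvg_trans _
  (c *: ((h * c)^-1 *: (f ((h * c) *: v + a) - f a)) @[h --> 0^'])).
  apply: near_eq_cvg; near=> h.
  by rewrite !scalerA invfM mulrCA divff // mulr1.
by apply: cvgZl_tmp; exact: (cvg_comp _ _ ch fdf).
Unshelve. all: by end_near. Qed.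

End LineDerivative.

Section Bilinear.
Context {R : realType} {V W1 W2 W3 : normedModType R}.
Variable B : W1 -> W2 -> W3.
Hypothesis Bl : forall w, linear (B^~ w).
Hypothesis Br : forall w, linear (B w).
Hypothesis Bc : forall w1 w2, B p.1 p.2 @[p --> (w1, w2)] --> B w1 w2.

Lemma is_derive_bilin (f : V -> W1) (g : V -> W2) a v df dg :
  is_derive a v f df -> is_derive a v g dg ->
  is_derive a v (fun x => B (f x) (g x)) (B df (g a) + B (f a) dg).
Proof.
move=> fdf gdg; have gc := is_derive_cvg_line gdg.
move: fdf gdg => /is_deriveP fdf /is_deriveP gdg; apply/is_deriveP.
have BlB w x y : B (x - y) w = B x w - B y w.
  by rewrite addrC -scaleN1r Bl scaleN1r addrC.
have BrB w x y : B w (x - y) = B w x - B w y.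
  by rewrite addrC -scaleN1r Br scaleN1r addrC.
have BlZ w c x : B (c *: x) w = c *: B x w.
  by rewrite -(addr0 (c *: x)) Bl -(subrr 0) BlB subrr addr0.
have BrZ w c x : B w (c *: x) = c *: B w x.
  by rewrite -(addr0 (c *: x)) Br -(subrr 0) BrB subrr addr0.
(* The increment is split as [B (f_h - f) g_h + B f (g_h - g)]; the first term uses continuity of
   [g] along the line. *)
rewrite [X in X @ _](_ : _ = fun h =>
    B (h^-1 *: (f (h *: v + a) - f a)) (g (h *: v + a)) +
    B (f a) (h^-1 *: (g (h *: v + a) - g a))); last first.
  by apply/funext => h; rewrite BlZ BrZ -scalerDr BlB BrB addrA subrK.
apply: cvgD.
  exact: (cvg_comp _ _ (cvg_pair fdf gc) (@Bc _ _)).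
exact: (cvg_comp _ _ (cvg_pair (cvg_cst (f a)) gdg) (@Bc _ _)).
Qed.

End Bilinear.

(** * Differentiability classes on [spd] *)

Section Ck.
Context {R : realType} {n : nat}.
Implicit Types X V : 'M[R]_n.

Lemma symmetric_mx_line X V (h : R) :
  symmetric_mx X -> symmetric_mx V -> symmetric_mx (h *: V + X).
Proof. by rewrite /symmetric_mx/= linearD linearZ /= => -> ->. Qed.

Lemma spd_line X V : spd X -> symmetric_mx V ->
  \forall h \near (0 : R)^', spd (h *: V + X).
Proof.
move=> pX sV; have : \forall h \near (0 : R)^',
    symmetric_mx (h *: V + X) -> spd (h *: V + X) := cvg_line V (spd_near pX).
by apply: filterS => h; apply; apply: symmetric_mx_line => //; case: pX.
Qed.

Section CkTheory.
Context {W : normedModType R}.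
Implicit Types f g : 'M[R]_n -> W.

Lemma is_derive_eq_spd f g X V df : spd X -> symmetric_mx V ->
  (forall Y, spd Y -> f Y = g Y) -> is_derive X V f df -> is_derive X V g df.
Proof.
move=> pX sV fg; apply: is_derive_near_line; last exact: fg.
by apply: filterS (spd_line pX sV) => h; exact: fg.
Qed.

Lemma Ck_continuous k f : Ck_on_spd k f -> {within spd, continuous f}.
Proof. by case: k => [|k] []. Qed.

Lemma Ck_is_derive k f X V : Ck_on_spd k.+1 f -> symmetric_mx V -> spd X ->
  is_derive X V f ('D_V f X).
Proof. by move=> [_ fk] /fk[fV _] pX; apply: derivableP; exact: fV. Qed.

Lemma Ck_derive k f V : Ck_on_spd k.+1 f -> symmetric_mx V ->
  Ck_on_spd k ('D_V f).
Proof. by move=> [_ fk] /fk[]. Qed.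

Lemma eq_Ck k f g : (forall X, spd X -> f X = g X) ->
  Ck_on_spd k f -> Ck_on_spd k g.
Proof.
elim: k f g => [|k IHk] f g fg fk; split=> //; try by
  apply: subspace_eq_continuous (Ck_continuous fk) => X /set_mem; exact: fg.
move=> V sV; split=> [X pX|].
  by case: (is_derive_eq_spd pX sV fg (Ck_is_derive fk sV pX)).
apply: IHk (Ck_derive fk sV) => X pX.
by case: (is_derive_eq_spd pX sV fg (Ck_is_derive fk sV pX)).
Qed.

(** Allows the derivative to be given by any formula valid on [spd], in place of ['D_V f] itself. *)
Lemma CkS k f : {within spd, continuous f} ->
  (forall V, symmetric_mx V -> exists2 df,
    forall X, spd X -> is_derive X V f (df X) & Ck_on_spd k df) ->
  Ck_on_spd k.+1 f.
Proof.
move=> fc fk; split=> // V /fk[df fdf dfk]; split=> [X /fdf[]//|].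
by apply: eq_Ck dfk => X /fdf[].
Qed.

Lemma Ck_pred k f : Ck_on_spd k.+1 f -> Ck_on_spd k f.
Proof.
elim: k f => [|k IHk] f fk; first by split=> //; exact: Ck_continuous fk.
apply: CkS (Ck_continuous fk) _ => V sV; exists ('D_V f).
  by move=> X; exact: Ck_is_derive fk sV.
by apply: IHk; exact: Ck_derive.
Qed.

Lemma Ck_cst k (w : W) : Ck_on_spd k (fun _ : 'M[R]_n => w).
Proof.
elim: k w => [|k IHk] w; first by split=> //; exact: cst_continuous.
apply: CkS; first exact: cst_continuous.
by move=> V _; exists (fun=> 0) => // X _; exact: is_derive_cst.
Qed.

Lemma Ck_add k f g : Ck_on_spd k f -> Ck_on_spd k g ->
  Ck_on_spd k (fun X => f X + g X).
Proof.
elim: k f g => [|k IHk] f g fk gk.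
  split=> //; apply/subspace_continuousP => X pX; apply: cvgD.
    by move/subspace_continuousP: fk.1; exact.
  by move/subspace_continuousP: gk.1; exact.
have [fk' gk'] := (Ck_pred fk, Ck_pred gk).
apply: CkS; first exact: Ck_continuous (IHk _ _ fk' gk').
move=> V sV; exists (fun X => 'D_V f X + 'D_V g X).
  by move=> X pX; apply: is_deriveD; apply: Ck_is_derive sV pX; eassumption.
by apply: IHk; exact: Ck_derive.
Qed.

Lemma Ck_sum k (I : Type) (r : seq I) (f : I -> 'M[R]_n -> W) :
  (forall i, Ck_on_spd k (f i)) -> Ck_on_spd k (fun X => \sum_(i <- r) f i X).
Proof.
move=> fk; elim: r => [|i r IHr].
  by under eq_fun do rewrite big_nil; exact: Ck_cst.
by under eq_fun do rewrite big_cons; exact: Ck_add.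
Qed.

End CkTheory.

Section CkBilinear.
Context {W1 W2 W3 : normedModType R}.
Variable B : W1 -> W2 -> W3.
Hypothesis Bl : forall w, linear (B^~ w).
Hypothesis Br : forall w, linear (B w).
Hypothesis Bc : forall w1 w2, B p.1 p.2 @[p --> (w1, w2)] --> B w1 w2.

(** By the product rule the derivative is a sum of two terms of the same shape, each covered by the
    induction hypothesis. *)
Lemma Ck_bilin k (f : 'M[R]_n -> W1) (g : 'M[R]_n -> W2) :
  Ck_on_spd k f -> Ck_on_spd k g -> Ck_on_spd k (fun X => B (f X) (g X)).
Proof.
elim: k f g => [|k IHk] f g fk gk.
  split=> //; apply/subspace_continuousP => X pX.
  have fc : f Y @[Y --> within spd (nbhs X)] --> f X.
    by move/subspace_continuousP: fk.1; exact.
  have gc : g Y @[Y --> within spd (nbhs X)] --> g X.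
    by move/subspace_continuousP: gk.1; exact.
  exact: (cvg_comp _ _ (cvg_pair fc gc) (@Bc _ _)).
have [fk' gk'] := (Ck_pred fk, Ck_pred gk).
apply: CkS; first exact: Ck_continuous (IHk _ _ fk' gk').
move=> V sV; exists (fun X => B ('D_V f X) (g X) + B (f X) ('D_V g X)).
  by move=> X pX; apply: is_derive_bilin => //;
    apply: Ck_is_derive sV pX; eassumption.
by apply: Ck_add; apply: IHk => //; exact: Ck_derive.
Qed.

End CkBilinear.

Section CkLinear.
Context {W1 W2 : normedModType R}.
Variable l : W1 -> W2.
Hypothesis ll : linear l.
Hypothesis lc : continuous l.

(** A linear map becomes a bilinear one with its scalar argument frozen at 1, so the bilinear lemmas
    apply. *)
Let B (s : R^o) w := s *: l w.
Let Bl w : linear (B^~ w).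
Proof. by move=> a s t; rewrite /B scalerDl scalerA. Qed.
Let Br s : linear (B s).
Proof. by move=> a u v; rewrite /B ll scalerDr !scalerA mulrC. Qed.
Let Bc s w : B p.1 p.2 @[p --> (s, w)] --> B s w.
Proof.
apply: cvgZ; first exact: cvg_fst.
by apply: (cvg_comp _ _ cvg_snd); exact: lc.
Qed.

Lemma Ck_lin k (f : 'M[R]_n -> W1) :
  Ck_on_spd k f -> Ck_on_spd k (fun X => l (f X)).
Proof.
move=> fk; apply: eq_Ck (Ck_bilin Bl Br Bc (Ck_cst k (1 : R^o)) fk) => X _.
by rewrite /B scale1r.
Qed.

Lemma is_derive_lin (V : normedModType R) (f : V -> W1) a v df :
  is_derive a v f df -> is_derive a v (fun x => l (f x)) (l df).
Proof.
move=> fdf; have := is_derive_bilin Bl Br Bc (is_derive_cst (1 : R^o) a v) fdf.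
rewrite /B scale0r add0r scale1r; under eq_fun do rewrite scale1r.
by [].
Qed.

End CkLinear.

End Ck.

(** * Smoothness of matrix expressions and of Lyapunov solutions *)

Section MatrixCk.
Context {R : realType} {n : nat}.
Implicit Types M X V : 'M[R]_n.

Lemma mulmx_cvg m p q (A : 'M[R]_(m, p)) (B : 'M[R]_(p, q)) :
  AB.1 *m AB.2 @[AB --> (A, B)] --> A *m B.
Proof. by apply: cvg_mulmx; [exact: cvg_fst|exact: cvg_snd]. Qed.

Lemma mulmx_linearl m p q (B : 'M[R]_(p, q)) :
  linear ((@mulmx R m p q)^~ B).
Proof. by move=> a x y; rewrite mulmxDl scalemxAl. Qed.

Lemma mulmx_linearr m p q (A : 'M[R]_(m, p)) : linear (@mulmx R m p q A).
Proof. by move=> a x y; rewrite mulmxDr scalemxAr. Qed.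

Lemma Ck_mulmx k (f g : 'M[R]_n -> 'M[R]_n) :
  Ck_on_spd k f -> Ck_on_spd k g -> Ck_on_spd k (fun X => f X *m g X).
Proof.
apply: (@Ck_bilin _ _ _ _ _ (@mulmx R n n n)).
- exact: mulmx_linearl.
- exact: mulmx_linearr.
- exact: mulmx_cvg.
Qed.

Lemma is_derive_mulmx (f g : 'M[R]_n -> 'M[R]_n) X V df dg :
  is_derive X V f df -> is_derive X V g dg ->
  is_derive X V (fun Y => f Y *m g Y) (df *m g X + f X *m dg).
Proof.
apply: (@is_derive_bilin _ _ _ _ _ (@mulmx R n n n)).
- exact: mulmx_linearl.
- exact: mulmx_linearr.
- exact: mulmx_cvg.
Qed.

Lemma Ck_scale k {W : normedModType R} (f : 'M[R]_n -> R^o) (g : 'M[R]_n -> W) :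
  Ck_on_spd k f -> Ck_on_spd k g -> Ck_on_spd k (fun X => f X *: g X).
Proof.
apply: (@Ck_bilin _ _ _ _ _ (fun (s : R^o) (w : W) => s *: w)).
- by move=> w a x y; rewrite scalerDl scalerA.
- by move=> s a x y; rewrite scalerDr !scalerA mulrC.
- by move=> s w; apply: cvgZ; [exact: cvg_fst|exact: cvg_snd].
Qed.

Lemma is_derive_scale {W : normedModType R} (f : 'M[R]_n -> R^o)
    (g : 'M[R]_n -> W) X V df dg :
  is_derive X V f df -> is_derive X V g dg ->
  is_derive X V (fun Y => f Y *: g Y) (df *: g X + f X *: dg).
Proof.
apply: (@is_derive_bilin _ _ _ _ _ (fun (s : R^o) (w : W) => s *: w)).
- by move=> w a x y; rewrite scalerDl scalerA.
- by move=> s a x y; rewrite scalerDr !scalerA mulrC.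
- by move=> s w; apply: cvgZ; [exact: cvg_fst|exact: cvg_snd].
Qed.

Lemma Ck_opp k {W : normedModType R} (f : 'M[R]_n -> W) :
  Ck_on_spd k f -> Ck_on_spd k (fun X => - f X).
Proof.
apply: (@Ck_lin _ _ _ _ (fun w : W => - w)); last exact: opp_continuous.
by move=> a x y; rewrite opprD scalerN.
Qed.

Lemma Ck_sub k {W : normedModType R} (f g : 'M[R]_n -> W) :
  Ck_on_spd k f -> Ck_on_spd k g -> Ck_on_spd k (fun X => f X - g X).
Proof. by move=> fk gk; apply: Ck_add fk _; exact: Ck_opp. Qed.

Lemma trmx_continuous : continuous (@trmx R n n).
Proof. by move=> A; apply: (@cvg_trmx _ _ (nbhs A)); exact: cvg_id. Qed.

Lemma Ck_trmx k (f : 'M[R]_n -> 'M[R]_n) :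
  Ck_on_spd k f -> Ck_on_spd k (fun X => (f X)^T).
Proof.
apply: (@Ck_lin _ _ _ _ (@trmx R n n)); first exact: linearP.
exact: trmx_continuous.
Qed.

Lemma Ck_sym_part k (f : 'M[R]_n -> 'M[R]_n) :
  Ck_on_spd k f -> Ck_on_spd k (fun X => sym_part (f X)).
Proof.
move=> fk; apply: Ck_scale; first exact: (@Ck_cst _ _ R^o).
by apply: Ck_add => //; exact: Ck_trmx.
Qed.

Lemma mx_coord_linear (i j : 'I_n) :
  linear (fun A : 'M[R]_n => A i j : R^o).
Proof. by move=> a A B; rewrite !mxE. Qed.

Lemma Ck_mx_coord k (f : 'M[R]_n -> 'M[R]_n) i j :
  Ck_on_spd k f -> Ck_on_spd k (fun X => f X i j : R^o).
Proof.
apply: (@Ck_lin _ _ _ R^o (fun A : 'M[R]_n => A i j : R^o)).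
- exact: mx_coord_linear.
- exact: coord_continuous.
Qed.

Lemma is_derive_mx_coord (f : 'M[R]_n -> 'M[R]_n) X V df i j :
  is_derive X V f df ->
  is_derive X V (fun Y => f Y i j : R^o) (df i j : R^o).
Proof.
apply: (@is_derive_lin _ _ R^o (fun A : 'M[R]_n => A i j : R^o)).
- exact: mx_coord_linear.
- exact: coord_continuous.
Qed.

Lemma is_derive_mxtrace (f : 'M[R]_n -> 'M[R]_n) X V df :
  is_derive X V f df -> is_derive X V (fun Y => \tr (f Y) : R^o) (\tr df : R^o).
Proof.
apply: (@is_derive_lin _ _ R^o (fun A : 'M[R]_n => \tr A : R^o)).
- by move=> a A B; rewrite linearP.
- by move=> A; apply: (@cvg_mxtrace _ _ (nbhs A)); exact: cvg_id.
Qed.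

Lemma is_derive_trmx (f : 'M[R]_n -> 'M[R]_n) X V df :
  is_derive X V f df -> is_derive X V (fun Y => (f Y)^T) df^T.
Proof.
apply: (@is_derive_lin _ _ _ (@trmx R n n)); first exact: linearP.
exact: trmx_continuous.
Qed.

(** Transposition commutes with the derivative, and [f] agrees with its transpose on [spd]. *)
Lemma derive_symmetric k (f : 'M[R]_n -> 'M[R]_n) X V :
  Ck_on_spd k.+1 f -> {homo f : Y / spd Y >-> symmetric_mx Y} ->
  spd X -> symmetric_mx V -> symmetric_mx ('D_V f X).
Proof.
move=> fk fs pX sV; rewrite /symmetric_mx/=; apply/esym.
have /is_derive_trmx := Ck_is_derive fk sV pX.
by move=> /(is_derive_eq_spd pX sV fs)[].
Qed.

(* With L_h the solution at X + h V, the difference quotient (L_h - L) / h is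
   exactly the solution, at X + h V, of the Lyapunov equation with right-hand
   side (U_h - U) / h - (V L M + M L V); only continuity is then needed. *)
Lemma is_derive_gen_lyapunov M X V (U : 'M[R]_n -> 'M[R]_n) dU :
  spd M -> spd X -> symmetric_mx V -> is_derive X V U dU ->
  let L := gen_lyapunov M X (U X) in
  is_derive X V (fun Y => gen_lyapunov M Y (U Y))
    (gen_lyapunov M X (dU - (V *m L *m M + M *m L *m V))).
Proof.
move=> pM pX sV /is_deriveP UdU L; apply/is_deriveP.
have pl := spd_line pX sV.
apply: (@cvg_trans _ (gen_lyapunov M (h *: V + X)
  (h^-1 *: (U (h *: V + X) - U X) - (V *m L *m M + M *m L *m V)) @[h --> 0^'])).
  apply: near_eq_cvg; near=> h.
  have ph : spd (h *: V + X) by near: h.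
  have h0 : h != 0 by near: h; exact: nbhs_dnbhs_neq.
  rewrite -[RHS](@gen_lyapunov_uniq _ _ M (h *: V + X)) //; congr gen_lyapunov.
  set L' := gen_lyapunov M (h *: V + X) _.
  have EL : X *m L *m M + M *m L *m X = U X by exact: gen_lyapunovP.
  have EL' : (h *: V + X) *m L' *m M + M *m L' *m (h *: V + X) = U (h *: V + X).
    exact: gen_lyapunovP.
  rewrite -/L -EL' -EL -!scalemxAr -!scalemxAl -scalerDr.
  rewrite -[X in _ - X](scalerK h0) -scalerBr; congr (_ *: _).
  rewrite !mulmxBr !mulmxBl [RHS]addrACA -!opprD -[LHS]addrA -opprD; congr (_ - _).
  rewrite !mulmxDl !mulmxDr -!scalemxAl -!scalemxAr scalerDr.
  by rewrite [RHS]addrACA [RHS]addrC.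
apply: cvg_gen_lyapunov => //; first exact: cvg_line.
by apply: cvgB => //; exact: cvg_cst.
Unshelve. all: by end_near. Qed.

(** Bootstrap: the derivative is again a Lyapunov solution, whose right-hand side involves ['D_V U]
    and the solution itself. The induction hypothesis is used first for the solution, then for its
    derivative. *)
Lemma Ck_gen_lyapunov k M (U : 'M[R]_n -> 'M[R]_n) : spd M ->
  Ck_on_spd k U -> Ck_on_spd k (fun X => gen_lyapunov M X (U X)).
Proof.
move=> pM; elim: k U => [|k IHk] U Uk.
  split=> //; apply/subspace_continuousP => X pX.
  apply: cvg_gen_lyapunov => //; first exact: withinT.
    exact: cvg_within.
  by move/subspace_continuousP: Uk.1; exact.
have Lk := IHk _ (Ck_pred Uk).
apply: CkS; first exact: Ck_continuous Lk.
move=> V sV; exists (fun X => gen_lyapunov M X ('D_V U X -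
    (V *m gen_lyapunov M X (U X) *m M + M *m gen_lyapunov M X (U X) *m V))).
  by move=> X pX; apply: is_derive_gen_lyapunov => //;
    exact: Ck_is_derive Uk sV pX.
apply: IHk; apply: Ck_sub; first exact: Ck_derive.
apply: Ck_add.
  by apply: Ck_mulmx; [apply: Ck_mulmx => //; exact: Ck_cst|exact: Ck_cst].
by apply: Ck_mulmx; [apply: Ck_mulmx => //; exact: Ck_cst|exact: Ck_cst].
Qed.

End MatrixCk.

(** * Linearity of the derivative in its direction *)

Section DirectionLinearity.
Context {R : realType} {n : nat}.
Implicit Types X Y V W : 'M[R]_n.

Lemma MVT_spd (f : 'M[R]_n -> R^o) Y V : Ck_on_spd 1 f -> symmetric_mx V ->
  (forall t : R, `|t| <= 1 -> spd (t *: V + Y)) ->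
  exists2 c : R, `|c| <= 1 & f (V + Y) - f Y = 'D_V f (c *: V + Y).
Proof.
move=> fk sV segY.
have itv (t : R) : t \in `[0, 1] -> `|t| <= 1.
  by rewrite in_itv /= => /andP[t0 t1]; rewrite ger0_norm.
pose phi (t : R) : R^o := f (t *: V + Y).
have phiD (t : R) : t \in `[0, 1] ->
    is_derive t (1 : R) phi ('D_V f (t *: V + Y)).
  move=> /itv/segY pt; have /is_deriveP fd := Ck_is_derive fk sV pt.
  apply/is_deriveP; rewrite [X in X @ _](_ : _ = fun h : R =>
    h^-1 *: (f (h *: V + (t *: V + Y)) - f (t *: V + Y))) //.
  by apply/funext => h; rewrite /phi addrA -scalerDl [_ *: 1]mulr1.
pose dphi (t : R) : R := 'D_V f (t *: V + Y).
have l01 : (0 : R) <= 1 by [].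
have phi_oo (t : R) : t \in `]0, 1[ -> is_derive t 1 (phi : R -> R) (dphi t).
  by move=> ts; apply: phiD; exact: subset_itv_oo_cc ts.
have phi_cont : {within `[0, 1], continuous phi}.
  by apply: derivable_within_continuous => t /phiD[].
have [t ts] := MVT_segment l01 phi_oo phi_cont.
rewrite subr0 mulr1 /phi scale1r scale0r add0r => fE.
by exists t => //; exact: itv.
Qed.

(* Only directional derivatives are available: additivity in the direction comes
   from the mean value theorem and the continuity of these derivatives. *)
Lemma derive_dir_linear_scalar (f : 'M[R]_n -> R^o) X (a : R) V W :
  Ck_on_spd 1 f -> spd X -> symmetric_mx V -> symmetric_mx W ->
  'D_(a *: V + W) f X = a *: 'D_V f X + 'D_W f X.
Proof.
move=> fk pX sV sW.
suff : is_derive X (a *: V + W) f (a *: 'D_V f X + 'D_W f X) by case.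
have /is_deriveP fW := Ck_is_derive fk sW pX.
apply/is_deriveP.
(* The increment is a path in two legs: from [X] along [h W], then along [h a V]. The second leg
   starts at a moving point and is handled by the mean value theorem. *)
rewrite [X in X @ _](_ : _ = fun h : R =>
    h^-1 *: (f ((h * a) *: V + (h *: W + X)) - f (h *: W + X)) +
    h^-1 *: (f (h *: W + X) - f X)); last first.
  apply/funext => h; rewrite -scalerDr addrA subrK.
  by rewrite -scalerA [in RHS](addrA (h *: _)) -[in RHS]scalerDr.
apply: cvgD => //.
apply/cvgrPdist_lt => e e0.
have D0 : \forall Y \near X, symmetric_mx Y ->
    spd Y /\ `|a *: 'D_V f X - a *: 'D_V f Y| < e.
  have /subspace_continuousP/(_ X pX) Dc := Ck_continuous (Ck_derive fk sV).
  have /cvgrPdist_lt/(_ e e0) :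
      a *: 'D_V f Y @[Y --> within spd (nbhs X)] --> a *: 'D_V f X.
    by apply: cvgZl_tmp; exact: Dc.
  rewrite near_withinE; apply: filterS2 (spd_near pX) => Y pY De /pY{}pY.
  by split => //; exact: De.
have /nbhs_ballP[d /= d0 Hd] := D0.
(* The whole second leg stays within [|h| K] of [X]; the summand 1 keeps [K] positive. *)
pose K := `|a| * `|V| + `|W| + 1.
have K0 : 0 < K by rewrite ltr_wpDl ?addr_ge0 ?mulr_ge0.
near=> h.
have hd : `|h| < d / K by near: h; apply: dnbhs0_lt; exact: divr_gt0.
have h0 : h != 0 by near: h; exact: nbhs_dnbhs_neq.
have small (t : R) : `|t| <= 1 ->
    ball X d (t *: ((h * a) *: V) + (h *: W + X)).
  move=> t1; rewrite -ball_normE /=.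
  rewrite [X in `|X|](_ : _ = - (t *: (h * a *: V) + h *: W)); last first.
    by rewrite [in LHS]addrA [_ + X]addrC opprD addrA subrr add0r.
  rewrite normrN; apply: (@le_lt_trans _ _ (`|h| * (`|a| * `|V| + `|W|))).
    rewrite (le_trans (ler_normD _ _)) // !normrZ mulrDr lerD //.
    by rewrite -mulrA ler_piMl // !mulr_ge0.
  apply: (@le_lt_trans _ _ (`|h| * K)); first by rewrite ler_wpM2l ?lerDl.
  by rewrite -ltr_pdivlMr.
have hs (t : R) : symmetric_mx (t *: ((h * a) *: V) + (h *: W + X)).
  rewrite scalerA; apply: symmetric_mx_line => //.
  by apply: symmetric_mx_line => //; case: pX.
have Ds t t1 := Hd _ (small t t1) (hs t).
have sV' : symmetric_mx ((h * a) *: V).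
  by rewrite /symmetric_mx/= linearZ/= sV.
have [t t1 ->] := MVT_spd fk sV' (fun t t1 => (Ds t t1).1).
have [pt De] := Ds t t1.
(* Homogeneity takes [h a] out of the direction, and the [h] cancels against [h^-1]. *)
have [_ ->] := is_derive_dirZ (h * a) (Ck_is_derive fk sV pt).
by rewrite (scalerA h^-1) mulKf.
Unshelve. all: by end_near. Qed.

End DirectionLinearity.

Section DerivAlong.
Context {R : realType} {n : nat}.
Implicit Types X Y V W : 'M[R]_n.

Lemma derive_dir_linear (f : 'M[R]_n -> 'M[R]_n) X (a : R) V W :
  Ck_on_spd 1 f -> spd X -> symmetric_mx V -> symmetric_mx W ->
  'D_(a *: V + W) f X = a *: 'D_V f X + 'D_W f X.
Proof.
move=> fk pX sV sW; apply/matrixP => i j; rewrite !mxE.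
have DE U : symmetric_mx U ->
    'D_U f X i j = 'D_U (fun Y => f Y i j : R^o) X.
  by move=> sU; case: (is_derive_mx_coord i j (Ck_is_derive fk sU pX)).
rewrite !DE //; last first.
  by rewrite /symmetric_mx/= linearD linearZ/= sV sW.
by apply: derive_dir_linear_scalar => //; exact: Ck_mx_coord.
Qed.

Lemma derive_dir_sum (f : 'M[R]_n -> 'M[R]_n) X I (r : seq I)
    (a : I -> R) (V : I -> 'M[R]_n) :
  Ck_on_spd 1 f -> spd X -> (forall i, symmetric_mx (V i)) ->
  'D_(\sum_(i <- r) a i *: V i) f X = \sum_(i <- r) a i *: 'D_(V i) f X.
Proof.
move=> fk pX sV; elim: r => [|i r IHr].
  by rewrite !big_nil; case: (is_derive0 f X).
rewrite !big_cons derive_dir_linear ?IHr //.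
rewrite /symmetric_mx/= linear_sum /=; apply: eq_bigr => j _.
by rewrite linearZ/= sV.
Qed.

Lemma sym_part_symmetric (A : 'M[R]_n) : symmetric_mx (sym_part A).
Proof. by rewrite /symmetric_mx/= linearZ linearD/= trmxK addrC. Qed.

Lemma sym_part_id (A : 'M[R]_n) : symmetric_mx A -> sym_part A = A.
Proof.
by move=> sA; rewrite /sym_part sA; apply/matrixP => i j; rewrite !mxE; lra.
Qed.

Lemma symmetric_mx_sum (V : 'M[R]_n) : symmetric_mx V ->
  V = \sum_(p : 'I_n * 'I_n) V p.1 p.2 *: sym_part (delta_mx p.1 p.2).
Proof.
move=> sV; rewrite -[LHS]sym_part_id // [in LHS](matrix_sum_delta V) pair_bigA /=.
rewrite /sym_part linear_sum /= -big_split scaler_sumr /=.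
apply: eq_bigr => p _; rewrite linearZ/= -scalerDr !scalerA.
by rewrite mulrC.
Qed.

(** The class is defined by fixed directions while [xi X] varies. Expanding [xi X] over symmetrized
    elementary matrices writes the derivative as a sum of entries of [xi] times derivatives in fixed
    directions. *)
Lemma Ck_deriv_along k (xi f : 'M[R]_n -> 'M[R]_n) :
  Ck_on_spd k xi -> {homo xi : X / spd X >-> symmetric_mx X} ->
  Ck_on_spd k.+1 f -> Ck_on_spd k (deriv_along xi f).
Proof.
move=> xik xis fk; have f1 : Ck_on_spd 1 f.
  by elim: k fk {xik} => // k IHk /Ck_pred.
pose S (p : 'I_n * 'I_n) : 'M[R]_n := sym_part (delta_mx p.1 p.2).
apply: (@eq_Ck _ _ _ _ (fun X => \sum_p (xi X p.1 p.2 : R^o) *: 'D_(S p) f X)).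
  move=> X pX; rewrite /deriv_along [in RHS](symmetric_mx_sum (xis X pX)).
  by rewrite derive_dir_sum // => p; exact: sym_part_symmetric.
apply: Ck_sum => p; apply: Ck_scale; first exact: Ck_mx_coord.
by apply: Ck_derive => //; exact: sym_part_symmetric.
Qed.

End DerivAlong.

(** * Levi-Civita connections *)

Section Uniqueness.
Context {R : realType} {n : nat}.
Variable g : 'M[R]_n -> 'M[R]_n -> 'M[R]_n -> R.
Hypothesis gC : forall X U V, spd X -> g X U V = g X V U.
Hypothesis gB : forall X U V W, spd X -> g X (U - V) W = g X U W - g X V W.
Hypothesis g_def : forall X U,
  spd X -> symmetric_mx U -> g X U U = 0 -> U = 0.

Lemma levi_civita_unique (nabla nabla' : connection_op) xi eta X :
  levi_civita g nabla -> levi_civita g nabla' ->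
  smooth_vector_field xi -> smooth_vector_field eta ->
  spd X -> nabla xi eta X = nabla' xi eta X.
Proof.
move=> [affn torn metn] [affn' torn' metn'] sxi seta pX.
pose D u v := nabla u v X - nabla' u v X.
pose svf := @smooth_vector_field R n.
have DC u v : svf u -> svf v -> D u v = D v u.
  move=> su sv; have := torn u v su sv X pX; rewrite -(torn' u v su sv X pX).
  move=> /matrixP h; apply/matrixP => i j; move: (h i j); rewrite !mxE; lra.
have Dskew u v w : svf u -> svf v -> svf w ->
    g X (D u v) (w X) = - g X (D u w) (v X).
  move=> su sv sw; have := metn u v w su sv sw X pX.
  rewrite (metn' u v w su sv sw X pX) !gB // ![g X (v X) _]gC //.
  by lra.
have sD : symmetric_mx (D xi eta).
  have := (connection_smooth affn sxi seta).2 X pX.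
  have := (connection_smooth affn' sxi seta).2 X pX.
  by rewrite /symmetric_mx/= linearB/= => -> ->.
(* The vector to be killed is extended to a constant field, so that it can be tested against
   itself. *)
pose zeta := fun _ : 'M[R]_n => D xi eta.
have szeta : svf zeta by split=> // k; exact: Ck_cst.
apply/eqP; rewrite -subr_eq0; apply/eqP; apply: (g_def pX sD).
(* Three skewness relations alternate with the symmetry of [D] and give
   [g (D xi eta) zeta = - g (D xi eta) zeta]. *)
have h1 := Dskew xi eta zeta sxi seta szeta.
have h2 := Dskew zeta xi eta szeta sxi seta.
have h3 := Dskew eta zeta xi seta szeta sxi.
rewrite (DC xi zeta) // in h1; rewrite (DC zeta eta) // in h2.
by rewrite (DC eta xi) // in h3; rewrite -[g _ _ _]/(g X (D xi eta) (zeta X)); lra.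
Qed.

End Uniqueness.

(** * The generalized Bures-Wasserstein metric and its connection *)

Section GBW.
Context {R : realType} {n : nat}.
Variable M : 'M[R]_n.
Hypothesis pM : spd M.
Implicit Types X U V : 'M[R]_n.

(** The derivative-free part of the connection in the global chart, as a map of tangent vectors,
    gathered under a single [sym_part]. *)
Definition christoffel X U V : 'M[R]_n :=
  let L := gen_lyapunov M X in
  sym_part (X *m L V *m M *m L U *m M + X *m L U *m M *m L V *m M
            - M *m L V *m U - M *m L U *m V).

Lemma sym_part_linear : linear (@sym_part R n).
Proof.
by move=> a A B; apply/matrixP => i j; rewrite !mxE; ring.
Qed.

Lemma sym_partB (A B : 'M[R]_n) : sym_part (A - B) = sym_part A - sym_part B.
Proof. by rewrite addrC -scaleN1r sym_part_linear scaleN1r addrC. Qed.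

Lemma gbw_connectionE xi eta X :
  gbw_connection M xi eta X =
  deriv_along xi eta X + christoffel X (xi X) (eta X).
Proof. by rewrite /christoffel !sym_partB !addrA. Qed.

Lemma christoffelC X U V : christoffel X U V = christoffel X V U.
Proof.
by rewrite /christoffel addrAC [X in sym_part (X - _ - _)]addrC.
Qed.

Lemma christoffel_linear X V : spd X -> linear ((christoffel X)^~ V).
Proof.
move=> pX a U U'; rewrite /christoffel -sym_part_linear gen_lyapunov_linear //.
congr sym_part; rewrite !(mulmxDr, mulmxDl, =^~scalemxAr, =^~scalemxAl).
have comb (p p' q q' r r' s s' : 'M[R]_n) :
    a *: p + p' + (a *: q + q') - (a *: r + r') - (a *: s + s') =
    a *: (p + q - r - s) + (p' + q' - r' - s').
  by apply/matrixP => i j; rewrite !mxE; ring.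
exact: comb.
Qed.

Lemma christoffel_symmetric X U V : symmetric_mx (christoffel X U V).
Proof. exact: sym_part_symmetric. Qed.

(** The skew part of [A] has zero trace pairing with a symmetric matrix. *)
Lemma trace_sym_partl (A C : 'M[R]_n) :
  symmetric_mx C -> \tr (sym_part A *m C) = \tr (A *m C).
Proof.
move=> sC; rewrite /sym_part -scalemxAl mxtraceZ mulmxDl mxtraceD.
rewrite -[\tr (A^T *m C)]mxtrace_tr trmx_mul trmxK sC mxtrace_mulC.
by lra.
Qed.

(** The Lyapunov operator is self-adjoint for the pairing [tr (A B)], by cyclicity, hence so is its
    inverse. *)
Lemma gen_lyapunov_adjoint X U V : spd X ->
  \tr (gen_lyapunov M X U *m V) = \tr (U *m gen_lyapunov M X V).
Proof.
move=> pX; have EU := gen_lyapunovP U pM pX; have EV := gen_lyapunovP V pM pX.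
set a := gen_lyapunov M X U in EU *; set b := gen_lyapunov M X V in EV *.
rewrite -[in LHS]EV -[in RHS]EU.
rewrite mulmxDr mulmxDl !mxtraceD addrC.
by congr (_ + _); rewrite !mulmxA [LHS]mxtrace_mulC !mulmxA.
Qed.

Lemma gbw_metricC X U V : spd X -> gbw_metric M X U V = gbw_metric M X V U.
Proof.
by move=> pX; rewrite /gbw_metric gen_lyapunov_adjoint // mxtrace_mulC.
Qed.

Lemma gbw_metric_linear X W : spd X ->
  linear (fun U => gbw_metric M X U W : R^o).
Proof.
move=> pX a U V; rewrite /gbw_metric gen_lyapunov_linear // mulmxDl -scalemxAl.
by rewrite mxtraceD mxtraceZ mulrDr mulrCA.
Qed.

Lemma gbw_metricD X U V W : spd X ->
  gbw_metric M X (U + V) W = gbw_metric M X U W + gbw_metric M X V W.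
Proof.
by move=> pX; have := gbw_metric_linear W pX 1 U V; rewrite !scale1r.
Qed.

Lemma gbw_metricB X U V W : spd X ->
  gbw_metric M X (U - V) W = gbw_metric M X U W - gbw_metric M X V W.
Proof.
move=> pX; have := gbw_metric_linear W pX (-1) V U.
by rewrite !scaleN1r !(addrC (- _)).
Qed.

Lemma gbw_metric_definite X U :
  spd X -> symmetric_mx U -> gbw_metric M X U U = 0 -> U = 0.
Proof.
move=> pX sU; have EU := gen_lyapunovP U pM pX; rewrite /gbw_metric.
have sL := gen_lyapunov_sym pM pX sU.
set L := gen_lyapunov M X U in EU sL *.
have -> : \tr (L *m U) = \tr (L^T *m X *m L *m M) + \tr (L^T *m M *m L *m X).
  by rewrite sL -[in LHS]EU mulmxDr mxtraceD !mulmxA.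
have [t1 h1] := trace_spd2_ge0 L pX pM; have [t2 _] := trace_spd2_ge0 L pM pX.
move=> /eqP; rewrite mulf_eq0 invr_eq0 pnatr_eq0 /= paddr_eq0 //.
by move=> /andP[/eqP/h1 L0 _]; rewrite -EU L0 !(mulmx0, mul0mx) addr0.
Qed.

(** The normal form, written [T] in the outline above, to which the traces below are reduced. *)
Definition trace6 X (p q r : 'M[R]_n) : R :=
  \tr (X *m p *m M *m q *m M *m r).

Lemma trace6_rev X p q r : spd X ->
  symmetric_mx p -> symmetric_mx q -> symmetric_mx r ->
  trace6 X p q r = trace6 X r q p.
Proof.
move=> pX sp sq sr; rewrite /trace6 -mxtrace_tr !trmx_mul sp sq sr.
by rewrite (spd_sym pM) (spd_sym pX) !mulmxA mxtrace_mulC !mulmxA.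
Qed.

(** The digit in the name counts the leading factors moved to the end to bring [X] to the front. *)
Lemma trace6_rot2 X p q r : \tr (M *m p *m X *m q *m M *m r) = trace6 X q r p.
Proof. by do 2!rewrite -!mulmxA mxtrace_mulC; rewrite /trace6 !mulmxA. Qed.

Lemma trace6_rot4 X p q r : \tr (M *m p *m M *m q *m X *m r) = trace6 X r p q.
Proof. by do 4!rewrite -!mulmxA mxtrace_mulC; rewrite /trace6 !mulmxA. Qed.

Lemma christoffel_trace X U V W : spd X ->
  symmetric_mx U -> symmetric_mx V -> symmetric_mx W ->
  let L := gen_lyapunov M X in
  \tr (christoffel X U V *m L W) = - 2 * trace6 X (L U) (L W) (L V).
Proof.
move=> pX sU sV sW L; rewrite trace_sym_partl; last exact: gen_lyapunov_sym.
have [EU EV] := (gen_lyapunovP U pM pX, gen_lyapunovP V pM pX).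
have [sa sb] := (gen_lyapunov_sym pM pX sU, gen_lyapunov_sym pM pX sV).
have sc := gen_lyapunov_sym pM pX sW; rewrite /L.
set a := gen_lyapunov M X U in EU sa *; set b := gen_lyapunov M X V in EV sb *.
set c := gen_lyapunov M X W in sc *; clearbody a b c.
(* Expressing [U] and [V] through [a] and [b] leaves six values of [T]: four cancel in pairs by
   reversal, and the other two both equal [- T(a,c,b)]. *)
rewrite -[in M *m b *m U]EU -[in M *m a *m V]EV.
rewrite !(mulmxDl, mulmxDr, mulNmx, mulmxA) !(mxtraceD, raddfN) /= !mxtraceD.
rewrite (trace6_rot2 X b a) (trace6_rot2 X a b) (trace6_rot4 X b a).
rewrite (trace6_rot4 X a b) -/(trace6 X b a c) -/(trace6 X a b c).
rewrite (trace6_rev pX sc sb sa) (trace6_rev pX sb sc sa).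
by rewrite (trace6_rev pX sc sa sb); lra.
Qed.

(** The matrix paired with [L W] is the derivative along [U] of [Y (L V) M + M (L V) Y] at [Y = X]
    with [L V] frozen: the contribution of the moving base point to the derivative of the metric. *)
Lemma lyapunov_trace X U V W : spd X ->
  symmetric_mx U -> symmetric_mx V -> symmetric_mx W ->
  let L := gen_lyapunov M X in
  \tr ((U *m L V *m M + M *m L V *m U) *m L W) =
  2 * trace6 X (L U) (L V) (L W) + 2 * trace6 X (L U) (L W) (L V).
Proof.
move=> pX sU sV sW L; have EU := gen_lyapunovP U pM pX.
have sa := gen_lyapunov_sym pM pX sU; have sb := gen_lyapunov_sym pM pX sV.
have sc := gen_lyapunov_sym pM pX sW; rewrite /L.
set a := gen_lyapunov M X U in EU sa *; set b := gen_lyapunov M X V in sb *.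
set c := gen_lyapunov M X W in sc *; clearbody a b c.
rewrite -EU !(mulmxDl, mulmxDr, mulmxA) !mxtraceD.
rewrite (trace6_rot2 X a b) (trace6_rot2 X b a) (trace6_rot4 X b a).
rewrite -/(trace6 X a b c) (trace6_rev pX sc sb sa) (trace6_rev pX sb sc sa).
by lra.
Qed.

Lemma gbw_connection_symmetric xi eta X :
  smooth_vector_field xi -> smooth_vector_field eta -> spd X ->
  symmetric_mx (gbw_connection M xi eta X).
Proof.
move=> [_ xis] [etak etas] pX; rewrite gbw_connectionE /symmetric_mx /=.
rewrite linearD /= christoffel_symmetric; congr (_ + _).
exact: derive_symmetric (etak 1%N) etas pX (xis X pX).
Qed.

Lemma Ck_id k : Ck_on_spd k (id : 'M[R]_n -> 'M[R]_n).
Proof.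
(* Aiming at order [k + 1] avoids a case split on [k]: the derivative is constant. *)
apply: Ck_pred; apply: CkS.
  by apply: continuous_subspaceT => X; exact: cvg_id.
move=> V _; exists (fun=> V); last exact: Ck_cst.
by move=> X _; exact: is_derive_id.
Qed.

Lemma gbw_connection_smooth xi eta :
  smooth_vector_field xi -> smooth_vector_field eta ->
  smooth_vector_field (gbw_connection M xi eta).
Proof.
move=> sxi seta; split=> [k|X pX]; last exact: gbw_connection_symmetric.
have [[xik xis] [etak _]] := (sxi, seta).
apply: (@eq_Ck _ _ _ _ _ _ (fun X _ => esym (gbw_connectionE xi eta X))).
apply: Ck_add; first exact: Ck_deriv_along.
have Lk (f : 'M[R]_n -> 'M[R]_n) : smooth_on_spd f ->
  Ck_on_spd k (fun X => gen_lyapunov M X (f X)).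
  by move=> fk; exact: Ck_gen_lyapunov.
have Mk : Ck_on_spd k (fun _ : 'M[R]_n => M) by exact: Ck_cst.
have Xk : Ck_on_spd k (fun X : 'M[R]_n => X) by exact: Ck_id.
have [ak bk] := (Lk _ xik, Lk _ etak).
apply: Ck_sym_part; apply: Ck_sub; [apply: Ck_sub; [apply: Ck_add|]|];
  do ![exact: Mk | exact: Xk | exact: ak | exact: bk | exact: xik | exact: etak
      | apply: Ck_mulmx].
Qed.

Lemma is_derive_smooth {W : normedModType R} (f : 'M[R]_n -> W) X V :
  smooth_on_spd f -> spd X -> symmetric_mx V -> is_derive X V f ('D_V f X).
Proof. by move=> fk pX sV; exact: Ck_is_derive (fk 1%N) sV pX. Qed.

Lemma gbw_affine : affine_connection (gbw_connection M).
Proof.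
split.
- move=> xi xi' eta eta' [_ xis] _ [etak _] _ exi eeta X /[dup] XS /set_mem pX.
  rewrite !gbw_connectionE -(exi X XS) -(eeta X XS); congr (_ + _).
  rewrite /deriv_along -(exi X XS).
  have /(is_derive_eq_spd pX (xis X pX)) := is_derive_smooth etak pX (xis X pX).
  by move=> /(_ eta') [] // Y pY; apply: eeta; exact: mem_set.
- exact: gbw_connection_smooth.
- move=> f xi xi' eta _ [_ xis] [_ xis'] [etak _] X pX.
  rewrite !gbw_connectionE /deriv_along christoffel_linear //.
  (* Linearity over functions in the first argument rests on linearity of the derivative in its
     direction. *)
  rewrite (derive_dir_linear (f X) (etak 1%N) pX (xis X pX) (xis' X pX)).
  by rewrite scalerDr addrACA.
- move=> a xi eta eta' [_ xis] [etak _] [etak' _] X pX.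
  have [de de'] := (is_derive_smooth etak pX (xis X pX),
                    is_derive_smooth etak' pX (xis X pX)).
  rewrite !gbw_connectionE ![christoffel _ (xi X) _]christoffelC.
  rewrite christoffel_linear // scalerDr addrACA; congr (_ + _).
  by case: (is_deriveD (is_deriveZ a de) de').
- move=> f xi eta fk [_ xis] [etak _] X pX.
  have [df de] := (is_derive_smooth fk pX (xis X pX),
                   is_derive_smooth etak pX (xis X pX)).
  rewrite !gbw_connectionE ![christoffel _ (xi X) _]christoffelC.
  (* Homogeneity is linearity with second vector 0; the instance at [-1], 0, 0 below shows that the
     value at the zero vector is 0. *)
  have := christoffel_linear (xi X) pX (f X) (eta X) 0.
  have := christoffel_linear (xi X) pX (-1) 0 0.
  rewrite scaleN1r oppr0 addr0 scaleN1r addNr => ->.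
  rewrite !addr0 => ->; rewrite scalerDr addrAC; congr (_ + _).
  by case: (is_derive_scale df de) => _; rewrite addrC.
Qed.

Lemma gbw_torsion_free : torsion_free (gbw_connection M).
Proof.
move=> xi eta _ _ X _; rewrite !gbw_connectionE christoffelC.
by rewrite opprD addrACA subrr addr0.
Qed.

Lemma gbw_metric_compatible :
  metric_compatible (gbw_metric M) (gbw_connection M).
Proof.
move=> xi eta zeta [_ xis] [etak etas] [zetak zetas] X pX.
have sx := xis X pX.
have [de dz] := (is_derive_smooth etak pX sx, is_derive_smooth zetak pX sx).
have dg := is_deriveZ (2^-1 : R) (is_derive_mxtrace (is_derive_mulmx
  (is_derive_gen_lyapunov pM pX sx de) dz)).
rewrite [LHS](@derive_val _ _ _ _ _ _ _ dg).
rewrite [gbw_metric M X (eta X) _]gbw_metricC // !gbw_connectionE.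
rewrite !gbw_metricD // [gbw_metric M X _ (eta X)]gbw_metricC // /gbw_metric.
rewrite ![\tr (gen_lyapunov M X (christoffel _ _ _) *m _)]gen_lyapunov_adjoint //.
rewrite !christoffel_trace; do ?by [exact: etas|exact: zetas|].
rewrite mxtraceD ![\tr (gen_lyapunov _ _ _ *m zeta X)]gen_lyapunov_adjoint //.
rewrite mulmxBl [\tr (_ - _)]raddfB /=.
rewrite lyapunov_trace; do ?by [exact: etas|exact: zetas|].
(* Here [p] and [q] are the traces with the Euclidean derivatives of [eta] and [zeta], [r] is
   [T(a,b,c)] and [s] is [T(a,c,b)]. *)
have comb (p q r s : R) : 2^-1 * (p - (2 * r + 2 * s) + q) =
  2^-1 * p + 2^-1 * (-2 * s) + (2^-1 * q + 2^-1 * (-2 * r)) by field.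
exact: comb.
Qed.

End GBW.

Theorem proposition10 (R : realType) (n : nat) (M : 'M[R]_n) (hM : spd M) :
  levi_civita (gbw_metric M) (gbw_connection M) /\
  forall nabla : connection_op, levi_civita (gbw_metric M) nabla ->
  forall xi eta : 'M[R]_n -> 'M[R]_n,
    smooth_vector_field xi -> smooth_vector_field eta ->
  forall X : 'M[R]_n, spd X -> nabla xi eta X = gbw_connection M xi eta X.
Proof.
have gbwLC : levi_civita (gbw_metric M) (gbw_connection M).
  split; [exact: gbw_affine|exact: gbw_torsion_free|].
  exact: gbw_metric_compatible.
split=> // nabla nablaLC xi eta sxi seta X pX.
apply: levi_civita_unique nablaLC gbwLC sxi seta pX.
- by move=> Y U V; exact: gbw_metricC.
- by move=> Y U V W; exact: gbw_metricB.
- by move=> Y U; exact: gbw_metric_definite.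
Qed.
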